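(* Let $A$ be an Abelian variety over a number field $K$, let $p>2$ be a prime, and let $L$ be a finite Galois extension of $K$ with Galois group isomorphic to $\mathrm{SL}_2(\mathbb{F}_p)$ or to $\mathrm{PSL}_2(\mathbb{F}_p)$. Then either $\operatorname{rk} A(L)= \operatorname{rk} A(K)$ or $\operatorname{rk} A(L)\geq \operatorname{rk} A(K)+\frac{p-1}{2}$.
   Context: $\operatorname{rk} A(F)$ denotes the Mordell–Weil rank of $A$ over the field $F$. *)

(* Defs.v *)
From HB Require Import structures.
From mathcomp Require Import all_boot all_order all_algebra.
From mathcomp Require Import all_fingroup all_solvable all_field.
From mathcomp Require Import mpoly.
From Stdlib Require Import ClassicalEpsilon.

Set Implicit Arguments.
Unset Strict Implicit.
Unset Printing Implicit Defensive.

Import GRing.Theory.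
Local Open Scope ring_scope.

(* Varieties are classical ones: their points are the points over algC, which is
   an algebraic closure of every number field embedded in it. *)

(* P^n(F) is the set of lines of F^(n+1). *)
Definition proj_space (F : fieldType) (n : nat) : Type :=
  {U : {vspace 'rV[F]_n.+1} | \dim U == 1}.

HB.instance Definition _ (F : fieldType) (n : nat) :=
  Choice.on (proj_space F n).

(* A choice of homogeneous coordinates. It is only used in (bi)homogeneous
   polynomials, where the choice does not matter. *)
Definition hcoord (F : fieldType) (n : nat) (P : proj_space F n) :
    'I_n.+1 -> F :=
  fun i => vpick (val P) 0 i.

Definition zero_locus (F : fieldType) (n : nat) (s : seq {mpoly F[n.+1]})
    (P : proj_space F n) : bool :=
  all (fun f => f.@[hcoord P] == 0) s.

Definition all_homog (F : fieldType) (n : nat) (s : seq {mpoly F[n]}) : bool :=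
  all (fun f => f \is homog [measure of mdeg]) s.

Definition zariski_closed (F : fieldType) (n : nat)
    (X : pred (proj_space F n)) : Prop :=
  exists2 s : seq {mpoly F[n.+1]}, all_homog s & X =1 zero_locus s.

Definition irreducible (F : fieldType) (n : nat)
    (X : pred (proj_space F n)) : Prop :=
  (exists P, X P) /\
  (forall Y Z : pred (proj_space F n), zariski_closed Y -> zariski_closed Z ->
     (forall P, X P -> Y P || Z P) ->
     (forall P, X P -> Y P) \/ (forall P, X P -> Z P)).

(* p, in the variables x_0, ..., x_n, y_0, ..., y_n, has degree d in x and
   degree e in y. *)
Definition bihomog (R : nzRingType) (n d e : nat)
    (p : {mpoly R[n.+1 + n.+1]}) : bool :=
  all (fun m : 'X_{1..n.+1 + n.+1} =>
         ((\sum_(i < n.+1) m (lshift n.+1 i))%N == d) &&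
         ((\sum_(i < n.+1) m (rshift n.+1 i))%N == e))
      (msupp p).

Section Varieties.

Variables (K : fieldType) (iota : {rmorphism K -> algC}).

Record proj_variety := ProjVariety {
  ambient_dim : nat;
  equations : seq {mpoly K[ambient_dim.+1]};
  equations_homog : all_homog equations;
  geom_irreducible :
    irreducible (zero_locus [seq map_mpoly iota f | f <- equations])
}.

Definition on_variety (X : proj_variety) : pred (proj_space algC (ambient_dim X)) :=
  zero_locus [seq map_mpoly iota f | f <- equations X].

Definition geom_point (X : proj_variety) : Type :=
  {P : proj_space algC (ambient_dim X) | on_variety P}.

Definition line_of (X : proj_variety) (P : geom_point X) :
    {vspace 'rV[algC]_(ambient_dim X).+1} :=
  val (val P).

(* X(F), for a field F embedded in algC. *)
Definition rational_point (F : fieldType) (j : {rmorphism F -> algC})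
    (X : proj_variety) (P : geom_point X) : Prop :=
  exists2 v : 'rV[F]_(ambient_dim X).+1, v != 0 &
    line_of P = <[map_mx j v]>%VS.

Definition eval1 (X : proj_variety)
    (f : 'I_(ambient_dim X).+1 -> {mpoly K[(ambient_dim X).+1]})
    (P : geom_point X) : 'rV[algC]_(ambient_dim X).+1 :=
  \row_i (map_mpoly iota (f i)).@[hcoord (val P)].

Definition eval2 (X : proj_variety)
    (f : 'I_(ambient_dim X).+1 ->
           {mpoly K[(ambient_dim X).+1 + (ambient_dim X).+1]})
    (P Q : geom_point X) : 'rV[algC]_(ambient_dim X).+1 :=
  \row_i (map_mpoly iota (f i)).@[fun k =>
    match split k with
    | inl a => hcoord (val P) a
    | inr b => hcoord (val Q) b
    end].

(* phi : X -> X is a morphism defined over K: near every point it is given by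
   homogeneous polynomials of the same degree with coefficients in K. *)
Definition morphism1 (X : proj_variety) (phi : geom_point X -> geom_point X) :
    Prop :=
  forall P, exists f d,
    [/\ forall i, f i \is d.-homog,
        eval1 f P != 0 &
        forall P', eval1 f P' != 0 -> line_of (phi P') = <[eval1 f P']>%VS].

(* The same for phi : X * X -> X, with X * X inside P^n * P^n. *)
Definition morphism2 (X : proj_variety)
    (phi : geom_point X -> geom_point X -> geom_point X) : Prop :=
  forall P Q, exists f d e,
    [/\ forall i, bihomog d e (f i),
        eval2 f P Q != 0 &
        forall P' Q', eval2 f P' Q' != 0 ->
          line_of (phi P' Q') = <[eval2 f P' Q']>%VS].

(* A projective variety over K with a group law given by morphisms over K.
   Commutativity is automatic for such a group law; having it as a field lets
   the points be a zmodType. *)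
Record abelian_variety := AbelianVariety {
  av_variety :> proj_variety;
  av_zero : geom_point av_variety;
  av_opp : geom_point av_variety -> geom_point av_variety;
  av_add : geom_point av_variety -> geom_point av_variety ->
           geom_point av_variety;
  av_zero_rational : rational_point iota av_zero;
  av_opp_morphism : morphism1 av_opp;
  av_add_morphism : morphism2 av_add;
  av_addA : associative av_add;
  av_addC : commutative av_add;
  av_add0 : left_id av_zero av_add;
  av_addN : left_inverse av_zero av_opp av_add
}.

Definition av_points (A : abelian_variety) : Type := geom_point A.

End Varieties.

HB.instance Definition _ (K : fieldType) (iota : {rmorphism K -> algC})
    (A : abelian_variety iota) :=
  [Choice of av_points A by <:].
HB.instance Definition _ (K : fieldType) (iota : {rmorphism K -> algC})
    (A : abelian_variety iota) :=
  GRing.isZmodule.Build (av_points A)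
    (@av_addA K iota A) (@av_addC K iota A) (@av_add0 K iota A)
    (@av_addN K iota A).

Inductive enat : Type := Fin of nat | Infty.

Definition enat_add (x y : enat) : enat :=
  match x, y with
  | Fin m, Fin n => Fin (m + n)
  | _, _ => Infty
  end.

Definition enat_le (x y : enat) : Prop :=
  match x, y with
  | Fin m, Fin n => (m <= n)%N
  | _, Infty => True
  | Infty, Fin _ => False
  end.

Section Rank.

Variable V : zmodType.

Definition z_independent (r : nat) (x : 'I_r -> V) : Prop :=
  forall c : 'I_r -> int, \sum_(i < r) x i *~ c i = 0 -> forall i, c i = 0.

Definition has_independent (S : V -> Prop) (r : nat) : Prop :=
  exists2 x : 'I_r -> V, (forall i, S (x i)) & z_independent x.

(* The maximal number of Z-linearly independent elements of S. *)
Definition z_rank (S : V -> Prop) : enat :=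
  match excluded_middle_informative
          (exists r, has_independent S r /\ ~ has_independent S r.+1) with
  | left h => Fin (proj1_sig (constructive_indefinite_description _ h))
  | right _ => Infty
  end.

End Rank.

(* rk A(F), for F embedded in algC by j. By the Mordell-Weil theorem it is finite
   when F is a number field. *)
Definition mw_rank (K : fieldType) (iota : {rmorphism K -> algC})
    (A : abelian_variety iota) (F : fieldType) (j : {rmorphism F -> algC}) :
    enat :=
  z_rank (fun P : av_points A => rational_point j (P : geom_point A)).

Local Open Scope group_scope.

Definition SL2 (p : nat) : {set {'GL_2(p)}} :=
  [set g : {'GL_2(p)} | \det (GLval g) == 1%R].

Lemma SL2_group_set (p : nat) : group_set (SL2 p).
Proof.
apply/group_setP; split=> [|g h]; rewrite !inE; first by rewrite det1.
by move=> /eqP dg /eqP dh; rewrite GL_ME det_mulmx dg dh mulr1.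
Qed.

Canonical SL2_group (p : nat) : {group {'GL_2(p)}} := Group (SL2_group_set p).

Definition PSL2 (p : nat) := SL2 p / 'Z(SL2 p).

(* Main.v *)
(* If s has order p in Gal(L/K) and w = s y - y is not torsion for some y in A(L),
   then w is killed by 1 + s + ... + s^(p-1), and the irreducibility of the p-th
   cyclotomic polynomial makes w, s w, ..., s^(p-2) w independent together with any
   independent family of A(K); the rank then jumps by at least p - 1. Otherwise
   every element of order p acts trivially on A(L) modulo torsion, and so does the
   whole group, because transvections, of order p, generate SL_2(F_p); taking traces
   then shows that A(K) and A(L) have the same rank. When A(L) has infinite z_rank
   there is nothing to prove, so that Mordell-Weil is not needed. *)

From HB Require Import structures.
Require Import Defs.
From mathcomp Require Import all_boot all_order all_algebra.
From mathcomp Require Import all_fingroup all_solvable all_field.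
From mathcomp Require Import mpoly ring.
From Stdlib Require Import Classical ClassicalEpsilon FunctionalExtensionality.

Set Implicit Arguments.
Unset Strict Implicit.
Unset Printing Implicit Defensive.

Import Order.TTheory GRing.Theory Num.Theory.
Local Open Scope ring_scope.

(** * Torsion elements and maximal independent families *)

Section Rank.

Variable V : zmodType.
Implicit Types (S T : V -> Prop) (v w : V).

Definition torsion v : Prop := exists2 n : int, n != 0 & v *~ n = 0.

Lemma torsion0 : torsion 0.
Proof. by exists 1 => //; rewrite mul0rz. Qed.

Lemma torsionD v w : torsion v -> torsion w -> torsion (v + w).
Proof.
move=> [m m0 vm] [n n0 wn]; exists (m * n); first by rewrite mulf_neq0.
by rewrite mulrzDl mulrzA vm mul0rz add0r mulrC mulrzA wn mul0rz.
Qed.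

Lemma torsionMz v n : torsion v -> torsion (v *~ n).
Proof.
by move=> [m m0 vm]; exists m => //; rewrite -mulrzA mulrC mulrzA vm mul0rz.
Qed.

Lemma torsion_sum (I : Type) (r : seq I) (P : pred I) (F : I -> V) :
  (forall i, P i -> torsion (F i)) -> torsion (\sum_(i <- r | P i) F i).
Proof. by move=> tF; elim/big_ind: _ => //; [exact: torsion0|exact: torsionD]. Qed.

Lemma has_independentW S r s :
  (s <= r)%N -> has_independent S r -> has_independent S s.
Proof.
elim: r => [|r IHr]; first by rewrite leqn0 => /eqP->.
rewrite leq_eqVlt => /predU1P[-> //|/IHr{}IHr] [x xS x_ind]; apply: IHr.
exists (fun i => x (lift ord0 i)) => // c c0 i.
(* A relation without the first vector is one with coefficient 0 there. *)
have := x_ind (fun i => oapp c 0 (unlift ord0 i)).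
rewrite big_ord_recl unlift_none /= add0r => /(_ _ (lift ord0 i)).
by rewrite liftK; apply; rewrite -[RHS]c0; apply: eq_bigr => j _; rewrite liftK.
Qed.

(** Independence passes to smaller sizes, so the maximal size chosen in [z_rank] is unique. *)
Lemma z_rankP S r :
  has_independent S r -> ~ has_independent S r.+1 -> z_rank S = Fin r.
Proof.
move=> Sr nSr; rewrite /z_rank; case: excluded_middle_informative => [h|[]]; last first.
  by exists r.
case: constructive_indefinite_description => /= s [Ss nSs]; congr Fin.
apply/eqP; rewrite eqn_leq; apply/andP; split; rewrite leqNgt; apply/negP => lt.
  exact/nSr/(has_independentW lt).
exact/nSs/(has_independentW lt).
Qed.

Lemma z_rank_fin S r : z_rank S = Fin r ->
  has_independent S r /\ ~ has_independent S r.+1.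
Proof.
rewrite /z_rank; case: excluded_middle_informative => // h.
by case: constructive_indefinite_description => s Ss [<-].
Qed.

Lemma eq_z_rank S T :
  (forall r, has_independent S r <-> has_independent T r) -> z_rank S = z_rank T.
Proof.
move=> ST; case DS: (z_rank S) => [r|]; first have [Sr nSr] := z_rank_fin DS.
  by symmetry; apply: z_rankP; [apply/ST|move/ST].
case DT: (z_rank T) => [r|//]; have [Tr nTr] := z_rank_fin DT.
by rewrite -DS; apply: z_rankP; [apply/ST|move/ST].
Qed.

Lemma z_rank_sub S T r : (forall v, T v -> S v) -> z_rank S = Fin r ->
  exists2 d, z_rank T = Fin d & has_independent T d.
Proof.
move=> TS /z_rank_fin[_ nSr].
have nTr : ~ has_independent T r.+1 by case=> x xT x_ind; apply: nSr; exists x; auto.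
suff [d [Td nTd]] : exists d, has_independent T d /\ ~ has_independent T d.+1.
  by exists d => //; apply: z_rankP.
(* Without a maximal size, independent families in [T] would exist in every size, starting from the
   empty one. *)
apply: NNPP => no_max; apply: nTr; elim: r.+1 => [|d IHd].
  by exists (fun i => 0); [case | move=> c _; case].
by apply: NNPP => nTd; apply: no_max; exists d.
Qed.

(** * The Z[X]-module structure defined by an additive endomorphism *)

Section PolyAction.

Variable f : {additive V -> V}.

(** This is [q(f)] applied to [v]: X acts as [f]. *)
Definition pact (q : {poly int}) (v : V) : V :=
  \sum_(i < size q) iter i f v *~ q`_i.

Lemma pactE n (q : {poly int}) v : (size q <= n)%N ->
  pact q v = \sum_(i < n) iter i f v *~ q`_i.
Proof.
move=> le_qn; rewrite /pact -!(big_mkord xpredT (fun i => iter i f v *~ q`_i)).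
rewrite (big_cat_nat (leq0n _) le_qn) /=.
rewrite [X in _ + X]big1_seq ?addr0 // => i /andP[_].
by rewrite mem_index_iota => /andP[le_qi _]; rewrite nth_default ?mulr0z.
Qed.

Lemma iter_zmod_morphism n : zmod_morphism (iter n f).
Proof. by elim: n => [|n IHn] v w //=; rewrite IHn raddfB. Qed.

Lemma pact_zmod_morphism q : zmod_morphism (pact q).
Proof.
move=> v w; rewrite /pact -sumrB; apply: eq_bigr => i _.
by rewrite iter_zmod_morphism mulrzBl.
Qed.

HB.instance Definition _ q :=
  GRing.isZmodMorphism.Build V V (pact q) (pact_zmod_morphism q).

Lemma pactD q1 q2 v : pact (q1 + q2) v = pact q1 v + pact q2 v.
Proof.
rewrite (pactE v (size_polyD q1 q2)) (pactE v (leq_maxl _ (size q2))).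
rewrite (pactE v (leq_maxr (size q1) _)) -big_split; apply: eq_bigr => i _.
by rewrite coefD mulrzDr.
Qed.

Lemma pactCM c q v : pact (c%:P * q) v = pact q v *~ c.
Proof.
have le_cq : (size (c%:P * q)%R <= size q)%N by rewrite mul_polyC size_scale_leq.
rewrite (pactE v le_cq) /pact mulrz_suml; apply: eq_bigr => i _.
by rewrite coefCM mulrC mulrzA.
Qed.

Lemma pactC c v : pact c%:P v = v *~ c.
Proof. by rewrite (pactE v (size_polyC_leq1 _)) big_ord1 coefC. Qed.

Lemma pactMX q v : pact (q * 'X) v = f (pact q v).
Proof.
have le_qX : (size (q * 'X)%R <= (size q).+1)%N.
  by rewrite (leq_trans (size_polyMleq _ _)) // size_polyX addn2.
rewrite (pactE v le_qX) big_ord_recl coefMX mulr0z add0r raddf_sum.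
by apply: eq_bigr => i _; rewrite coefMX /= raddfMz.
Qed.

Lemma pactM q1 q2 v : pact (q1 * q2) v = pact q1 (pact q2 v).
Proof.
elim/poly_ind: q1 => [|q1 c IHq]; first by rewrite mul0r /pact size_poly0 !big_ord0.
rewrite mulrDl pactD pactCM pactD pactC pactMX -IHq -pactMX.
by rewrite -!mulrA [q2 * 'X]mulrC.
Qed.

End PolyAction.

End Rank.

(** * Bezout relations with the p-th cyclotomic polynomial *)

(** The sum 1 + X + ... + X^(p-1) is irreducible over Q of degree p - 1, hence prime to any nonzero
    [q] of smaller degree; clearing denominators in a Bezout relation over Q gives [n]. *)
Lemma cyclotomic_bezout p (q : {poly int}) : prime p -> q != 0 ->
  (size q < p)%N ->
  exists u v : {poly int}, exists2 n : int, n != 0 &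
    u * q + v * \poly_(i < p) 1 = n%:P.
Proof.
move=> p_pr q0 lt_qp; have p_gt0 := prime_gt0 p_pr.
have [z prim_z] := C_prim_root_exists p_gt0.
have [m [Dm mon_m] dv_m] := minCpolyP z.
have sz_m : size m = p.
  rewrite -(size_map_poly (@ratr algC)) -Dm (minCpoly_cyclotomic prim_z).
  by rewrite size_cyclotomic totient_prime // prednK.
(* If m = h g, then [z] is a root of [h] or of [g], and by minimality that factor has the full
   degree of [m]. *)
have m_irr (g : {poly rat}) : g %| m -> size g != 1%N -> g %= m.
  move=> g_m sz_g; have /dvdpP[h Dh] := g_m; have m0 : m != 0 by rewrite monic_neq0.
  have [h0 g0] : h != 0 /\ g != 0.
    by apply/andP; rewrite -negb_or -mulf_eq0 -Dh.
  have : root (map_poly ratr m) z by rewrite -Dm root_minCpoly.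
  rewrite Dh rmorphM rootM !dv_m => /orP[] /dvdp_leq; rewrite ?h0 ?g0 => /(_ isT).
    rewrite Dh size_mul // -ltnS -(prednK (n := size g)) ?size_poly_gt0 // addnS /=.
    move=> le; case/eqP: sz_g; apply/eqP; rewrite eqn_leq size_poly_gt0 g0 andbT.
    by move: le; rewrite -{2}[size h]addn0 ltnS leq_add2l; case: (size g) => [|[]].
  by move=> le_mg; rewrite -Dh -dvdp_size_eqp // eqn_leq le_mg dvdp_leq.
pose s : {poly rat} := \poly_(i < p) 1.
have co_ms : coprimep (map_poly intr q) s.
  (* Since [z] has order p and differs from 1, the geometric sum [s] vanishes at [z]; so [m] divides
     [s], and the sizes agree. *)
  have sm : s %= m.
    rewrite eqp_sym -dvdp_size_eqp ?sz_m ?size_poly_eq ?oner_neq0 // -dv_m.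
    have -> : map_poly ratr s = \poly_(i < p) 1 :> {poly algC}.
      apply/polyP=> i; rewrite coef_map !coef_poly.
      by case: ifP => _; [apply: rmorph1 | apply: rmorph0].
    rewrite /root horner_poly.
    have z1 : z - 1 != 0.
      rewrite subr_eq0 -[z]expr1 -(prim_order_dvd prim_z) dvdn1.
      by rewrite gtn_eqF ?prime_gt1.
    apply/eqP/(mulfI z1); rewrite mulr0; have := subrX1 z p.
    rewrite (prim_expr_order prim_z) subrr => zp; rewrite [RHS]zp; congr (_ * _).
    by apply: eq_bigr => i _; rewrite mul1r.
  have sz_q : size (map_poly intr q : {poly rat}) = size q.
    by apply: size_map_inj_poly; first exact: intr_inj.
  rewrite (eqp_coprimepr _ sm) /coprimep; apply/idPn => /(m_irr _ (dvdp_gcdr _ _)) gm.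
  have : m %| map_poly intr q by rewrite -(eqp_dvdl _ gm) dvdp_gcdl.
  move/dvdp_leq; rewrite -size_poly_eq0 sz_q sz_m size_poly_eq0 q0 leqNgt lt_qp.
  by move/(_ isT).
have [[u v] /= uv1] := Bezout_eq1_coprimepP _ _ co_ms.
(* The integers [a] and [b] are denominators of [u] and [v]; the relation gets multiplied by
   [a * b]. *)
have [[u1 [a a0 Du]] [v1 [b b0 Dv]]] := (rat_poly_scale u, rat_poly_scale v).
exists (b *: u1), (a *: v1); exists (a * b); first by rewrite mulf_neq0.
apply: (map_inj_poly (@intr_inj rat)) => //.
have Ds : map_poly intr (\poly_(i < p) 1) = s.
  by apply/polyP=> i; rewrite coef_map !coef_poly; case: ifP.
have [aQ bQ] : a%:~R != 0 :> rat /\ b%:~R != 0 :> rat by rewrite !intr_eq0.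
rewrite rmorphD !rmorphM /= !map_polyZ /= map_polyC /= Ds map_polyC /= -[RHS]mulr1.
rewrite -uv1 Du Dv mulrDr -!mul_polyC.
have -> : (a%:~R)%:P * (b%:~R)%:P *
    ((a%:~R)^-1%:P * map_poly intr u1 * map_poly intr q) =
  (a%:~R / a%:~R)%:P * ((b%:~R)%:P * map_poly intr u1 * map_poly intr q) :> {poly rat}.
  by rewrite polyCM; ring.
have -> : (a%:~R)%:P * (b%:~R)%:P * ((b%:~R)^-1%:P * map_poly intr v1 * s) =
  (b%:~R / b%:~R)%:P * ((a%:~R)%:P * map_poly intr v1 * s) :> {poly rat}.
  by rewrite polyCM; ring.
by rewrite !mulfV // !mul1r.
Qed.

(** * Groups generated by elements of exponent p *)

Section ExponentGenerated.

Local Open Scope group_scope.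

(** Asking for [x ^+ p = 1] instead of order exactly p makes the property pass to images, where [x]
    may become trivial. *)
Definition gen_by_exponent (p : nat) (gT : finGroupType) (G : {set gT}) : Prop :=
  G \subset <<[set x in G | x ^+ p == 1]>>.

Lemma gen_by_exponent_morphim p (aT rT : finGroupType) (D G : {group aT})
    (f : {morphism D >-> rT}) :
  G \subset D -> gen_by_exponent p G -> gen_by_exponent p (f @* G).
Proof.
rewrite /gen_by_exponent => sGD /(morphimS f) /subset_trans; apply.
have sXD : [set x in G | x ^+ p == 1] \subset D.
  by apply: subset_trans sGD; apply/subsetP => x; rewrite inE => /andP[].
rewrite morphim_gen //; apply: genS; apply/subsetP => _ /morphimP[x Dx + ->].
rewrite !inE => /andP[Gx /eqP xp1]; rewrite mem_morphim //=.
by rewrite -morphX // xp1 morph1.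
Qed.

Lemma gen_by_exponent_isog p (aT rT : finGroupType) (G : {group aT})
    (H : {group rT}) : G \isog H -> gen_by_exponent p H -> gen_by_exponent p G.
Proof.
rewrite isog_sym => /isogP[f _ <-].
exact: gen_by_exponent_morphim.
Qed.

End ExponentGenerated.

(** * Transvections generate SL_2(F_p) *)

Section SL2.

Variables (p : nat).
Hypothesis p_pr : prime p.
Local Notation F := 'F_p.

Definition mx22 (a b c d : F) : 'M[F]_2 :=
  \matrix_(i, j) if i == 0 then if j == 0 then a else b
                 else if j == 0 then c else d.

Lemma mx22_eta (M : 'M[F]_2) : M = mx22 (M 0 0) (M 0 1) (M 1 0) (M 1 1).
Proof.
apply/matrixP=> i j; rewrite mxE.
by case: i j => [[|[|//]] ip] [[|[|//]] jp] /=; congr (M _ _); apply: val_inj.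
Qed.

Lemma mul_mx22 a b c d a' b' c' d' : mx22 a b c d * mx22 a' b' c' d' =
  mx22 (a * a' + b * c') (a * b' + b * d') (c * a' + d * c') (c * b' + d * d').
Proof.
apply/matrixP=> i j; rewrite !mxE !big_ord_recl big_ord0 !mxE /= addr0.
by case: ifP; case: ifP.
Qed.

Lemma det_mx22 a b c d : \det (mx22 a b c d) = a * d - b * c.
Proof.
rewrite (expand_det_row _ ord0) !big_ord_recl big_ord0 /cofactor !det_mx11 !mxE /=.
by rewrite addr0 expr0 expr1 mul1r mulN1r mulrN.
Qed.

(** A singular [M] is sent to the default value 1; by [gl22K] this does not occur at determinant
    1. *)
Definition gl22 (M : 'M[F]_2) : {'GL_2(p)} := insubd (1%g : {'GL_2(p)}) M.

Lemma gl22K M : \det M = 1 -> GLval (gl22 M) = M.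
Proof. by move=> M1; rewrite /gl22 insubdK // unitmxE M1 unitr1. Qed.

Definition upper (x : F) := gl22 (mx22 1 x 0 1).
Definition lower (x : F) := gl22 (mx22 1 0 x 1).

Lemma upperE x : GLval (upper x) = mx22 1 x 0 1.
Proof. by rewrite gl22K // det_mx22 mulr1 mulr0 subr0. Qed.

Lemma lowerE x : GLval (lower x) = mx22 1 0 x 1.
Proof. by rewrite gl22K // det_mx22 mulr1 mul0r subr0. Qed.

Lemma upperX x n : (upper x ^+ n)%g = upper (x *+ n).
Proof.
elim: n => [|n IHn]; apply: val_inj; rewrite /= ?upperE.
  by rewrite mulr0n [RHS]mx22_eta [LHS]mx22_eta !mxE.
rewrite expgS IHn GL_ME !upperE mul_mx22 mulrS.
by congr mx22; ring.
Qed.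

Lemma lowerX x n : (lower x ^+ n)%g = lower (x *+ n).
Proof.
elim: n => [|n IHn]; apply: val_inj; rewrite /= ?lowerE.
  by rewrite mulr0n [RHS]mx22_eta [LHS]mx22_eta !mxE.
rewrite expgS IHn GL_ME !lowerE mul_mx22 mulrS.
by congr mx22; ring.
Qed.

Lemma SL2_gen_by_exponent : gen_by_exponent p (SL2 p).
Proof.
set X := [set x in SL2 p | x ^+ p == 1]%g.
have pF (x : F) : x *+ p = 0 by rewrite -mulr_natr (pchar_Fp_0 p_pr) mulr0.
(* To compare [upper 0] with the identity, the latter is written as the zeroth power of
   [upper 0]. *)
have Xu x : upper x \in (<<X>>)%g.
  rewrite mem_gen // !inE upperE det_mx22 mulr1 mulr0 subr0 eqxx.
  by rewrite upperX pF -[X in _ == X](expg0 (upper 0)) upperX mulr0n eqxx.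
have Xl x : lower x \in (<<X>>)%g.
  rewrite mem_gen // !inE lowerE det_mx22 mulr1 mul0r subr0 eqxx.
  by rewrite lowerX pF -[X in _ == X](expg0 (lower 0)) lowerX mulr0n eqxx.
(* A matrix with lower left entry c != 0 is a product upper * lower * upper. *)
have gen_c (g : {'GL_2(p)}) :
    \det (GLval g) = 1 -> GLval g 1 0 != 0 -> g \in (<<X>>)%g.
  rewrite [GLval g]mx22_eta det_mx22; set a : F := GLval g 0 0; set b : F := GLval g 0 1.
  set c : F := GLval g 1 0; set d : F := GLval g 1 1 => g1; rewrite mxE /= => c0.
  (* The diagonal entries [a] and [d] dictate the two upper parameters; determinant 1 then forces
     [b]. *)
  suff Dg : GLval g = GLval (upper ((a - 1) / c)%R * lower c * upper ((d - 1) / c)%R).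
    by rewrite (val_inj Dg) !groupM ?Xu ?Xl.
  rewrite [LHS]mx22_eta !GL_ME !upperE lowerE !mul_mx22.
  have Db : b = (a * d - 1) / c by rewrite -g1; field.
  by rewrite -/a -/b -/c -/d Db; congr mx22; field.
apply/subsetP=> g; rewrite inE => /eqP g1.
have [c0|] := eqVneq (GLval g 1 0) 0; last exact: gen_c.
(* When c = 0, right multiplication by [lower 1] moves d, which is nonzero, into the lower left
   corner. *)
rewrite -(groupMr _ (Xl 1)); apply: gen_c.
  by rewrite GL_ME det_mulmx g1 lowerE det_mx22 !mul1r mul0r subr0.
have d0 : GLval g 1 1 != 0.
  apply/eqP => d0; move: g1; rewrite [GLval g]mx22_eta det_mx22 c0 d0 !mulr0 subr0.
  by move/esym/eqP; rewrite oner_eq0.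
by rewrite GL_ME lowerE [GLval g]mx22_eta mul_mx22 mxE /= c0 mul0r add0r mulr1.
Qed.

End SL2.

(** * The rank jump caused by an automorphism of exponent p *)

Section CyclicJump.

Variables (V : zmodType) (S : V -> Prop) (f : {additive V -> V}) (p : nat).
Hypotheses (p_pr : prime p) (fS : forall v, S v -> S (f v)).
Hypothesis (f_exp : forall v, S v -> iter p f v = v).

(* Phi = 1 + X + ... + X^(p-1) kills w = f y - y and multiplies each x_i by p, so
   applying it to a relation between the x_i and the f^j w isolates the x_i; what
   is left is a relation q(f) w = 0 with deg q < p - 1, and q is prime to Phi. *)
Lemma has_independent_jump (y : V) d (x : 'I_d -> V) :
  S y -> S (f y - y) -> ~ torsion (f y - y) ->
  (forall i, S (x i)) -> (forall i, f (x i) = x i) -> z_independent x ->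
  has_independent S (d + p.-1).
Proof.
move=> Sy; set w := f y - y => Sw w_ntors Sx fx x_ind.
pose Phi : {poly int} := \poly_(i < p) 1.
have pactPhi v : pact f Phi v = \sum_(i < p) iter i f v.
  rewrite (pactE _ _ (size_poly _ _)); apply: eq_bigr => i _.
  by rewrite coef_poly ltn_ord mulr1z.
have Phi_w : pact f Phi w = 0.
  rewrite pactPhi -(big_mkord xpredT (fun i => iter i f w)).
  (* As f^i w = f^(i+1) y - f^i y, the sum telescopes to f^p y - y. *)
  rewrite (telescope_sumr_eq (fun i => iter i f y)) //; last first.
    by move=> i _; rewrite iter_zmod_morphism -iterSr.
  by rewrite f_exp // subrr.
have Phi_iter j : pact f Phi (iter j f w) = 0.
  elim: j => //= j; rewrite -{2}(raddf0 f) => <-.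
  rewrite !pactPhi raddf_sum; apply: eq_bigr => i _.
  by rewrite -iterS -iterSr.
have Phi_x i : pact f Phi (x i) = x i *+ p.
  rewrite pactPhi (eq_bigr (fun=> x i)) ?sumr_const ?card_ord // => j _.
  by elim: (nat_of_ord j) => //= k ->.
exists (fun k => match split k with inl i => x i | inr j => iter j f w end).
  move=> k; case: split => // j.
  by elim: (nat_of_ord j) => //= n; apply: fS.
move=> c; rewrite big_split_ord /=.
under eq_bigr do rewrite (unsplitK (inl _)).
under [X in _ + X]eq_bigr do rewrite (unsplitK (inr _)).
move=> c0.
have cl i : c (lshift _ i) = 0.
  have := congr1 (pact f Phi) c0; rewrite raddfD !raddf_sum raddf0 /=.
  rewrite [X in _ + X]big1 ?addr0 => [|j _]; last by rewrite raddfMz /= Phi_iter mul0rz.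
  rewrite (eq_bigr (fun i => x i *~ (p%:Z * c (lshift _ i)))) => [/x_ind/(_ i)/eqP|{}i _].
    by rewrite mulf_eq0 eqz_nat gtn_eqF ?prime_gt0 // => /eqP.
  by rewrite raddfMz /= Phi_x mulrzA pmulrn.
move: c0; rewrite big1 ?add0r => [|i _]; last by rewrite cl mulr0z.
pose q : {poly int} := \poly_(j < p.-1) oapp (fun j => c (rshift d j)) 0 (insub j).
have q_coef (j : 'I_p.-1) : q`_j = c (rshift d j).
  by rewrite coef_poly ltn_ord valK.
move=> c0; have q_w : pact f q w = 0.
  by rewrite -[RHS]c0 (pactE _ _ (size_poly _ _)); apply: eq_bigr => j _; rewrite q_coef.
have q0 : q = 0.
  (* If [q] were nonzero, [u * q + v * Phi = n] would give n w = 0, although [w] is not torsion. *)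
  apply/eqP/idPn => /(cyclotomic_bezout p_pr)[|u [v [n n0 uv]]].
    by rewrite (leq_ltn_trans (size_poly _ _)) // prednK ?prime_gt0.
  case: w_ntors; exists n => //.
  by rewrite -(pactC f) -uv pactD !pactM q_w Phi_w !raddf0 addr0.
by move=> k; rewrite -[k]splitK; case: split => j /=; rewrite // -q_coef q0 coef0.
Qed.

End CyclicJump.

(** * A finite group acting on a subgroup [S] with fixed points [T] *)

Section Dichotomy.

Variables (gT : finGroupType) (G : {group gT}) (V : zmodType).
Variables (act : gT -> {additive V -> V}) (S T : V -> Prop).

Hypotheses (S0 : S 0) (SB : forall v w, S v -> S w -> S (v - w)).
Hypotheses (actS : forall g v, g \in G -> S v -> S (act g v)).
Hypothesis act1 : forall v, S v -> act 1%g v = v.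
Hypothesis actM : forall g h v, g \in G -> h \in G -> S v ->
  act (g * h)%g v = act h (act g v).
Hypothesis TE : forall v, T v <-> S v /\ forall g, g \in G -> act g v = v.

Let SN v : S v -> S (- v).
Proof. by rewrite -sub0r; apply: SB. Qed.

Let SD v w : S v -> S w -> S (v + w).
Proof. by move=> Sv Sw; rewrite -[w]opprK; apply: SB => //; apply: SN. Qed.

Let S_sum (I : Type) (r : seq I) (P : pred I) F :
  (forall i, P i -> S (F i)) -> S (\sum_(i <- r | P i) F i).
Proof. by move=> SF; elim/big_ind: _. Qed.

Lemma act_exp g n v : g \in G -> S v -> act (g ^+ n)%g v = iter n (act g) v.
Proof.
move=> Gg Sv; elim: n => [|n IHn]; first exact: act1.
by rewrite expgSr actM ?groupX // IHn.
Qed.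

Lemma act_trace_fixed v : S v -> T (\sum_(g in G) act g v).
Proof.
move=> Sv; apply/TE; split=> [|h Gh]; first by apply: S_sum => g Gg; apply: actS.
rewrite raddf_sum [RHS](reindex_inj (mulIg h)) /=; apply: eq_big => g.
  by rewrite groupMr.
by move=> Gg; rewrite actM.
Qed.

(** Modulo torsion the trace of [x i] is #|G| times [x i], so a relation between the traces,
    multiplied by some nonzero [n], becomes a relation between the [x i]. *)
Lemma has_independent_fixed r :
  (forall g v, g \in G -> S v -> torsion (act g v - v)) ->
  has_independent S r -> has_independent T r.
Proof.
move=> tors [x Sx x_ind].
exists (fun i => \sum_(g in G) act g (x i)); first by move=> i; apply: act_trace_fixed.
move=> c c0 i.
have [n n0] : torsion (\sum_i (\sum_(g in G) (act g (x i) - x i)) *~ c i).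
  by apply: torsion_sum => j _; apply/torsionMz/torsion_sum => g Gg; apply: tors.
under eq_bigr do rewrite sumrB mulrzBl sumr_const.
rewrite sumrB c0 sub0r mulNrz => /eqP; rewrite oppr_eq0 mulrz_suml => /eqP.
under eq_bigr do rewrite pmulrn -!mulrzA.
move/x_ind/(_ i)/eqP; rewrite !mulf_eq0 (negPf n0) orbF eqz_nat.
by rewrite gtn_eqF ?cardG_gt0 //= => /eqP.
Qed.

(** Induction on the length of a word in [A]: with h the last letter and g the rest, h(g v) - v =
    h(g v - v) + (h v - v), and h preserves torsion. *)
Lemma torsion_act_gen (A : {set gT}) :
  A \subset G -> (forall g v, g \in A -> S v -> torsion (act g v - v)) ->
  forall g v, g \in (<<A>>)%g -> S v -> torsion (act g v - v).
Proof.
move=> sAG tA g v /gen_prodgP[n [c Ac ->]] Sv.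
elim: n c Ac => [|n IHn] c Ac; first by rewrite big_ord0 act1 // subrr; apply: torsion0.
have Gc i : c i \in G by rewrite (subsetP sAG).
rewrite big_ord_recr /= actM ?group_prod //.
rewrite -(subrK (act (c ord_max) v) (act _ _)) -addrA -raddfB.
apply: torsionD; last exact: tA.
have [m m0 vm] := IHn _ (fun i => Ac (widen_ord (leqnSn n) i)).
by exists m; rewrite // -raddfMz vm raddf0.
Qed.

Lemma z_rank_dichotomy p : prime p -> gen_by_exponent p G ->
  z_rank S = z_rank T \/ enat_le (enat_add (z_rank T) (Fin p.-1)) (z_rank S).
Proof.
move=> p_pr genG; case DS: (z_rank S) => [r|]; last by right; case: (z_rank T).
have TS v : T v -> S v by case/TE.
have [d DT [x Tx x_ind]] := z_rank_sub TS DS; rewrite DT.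
set A := [set g in G | g ^+ p == 1]%g.
have [[g [v [Ag Sv ntors]]]|no_ntors] :=
  classic (exists g v, [/\ g \in A, S v & ~ torsion (act g v - v)]).
  right; have [Gg /eqP gp1] : g \in G /\ (g ^+ p == 1)%g by apply/andP; rewrite inE in Ag.
  have Sw : S (act g v - v) by apply: SB => //; apply: actS.
  have := @has_independent_jump V S (act g) p p_pr (fun v => @actS g v Gg) _
    v d x Sv Sw ntors.
  have [_ nSr] := z_rank_fin DS.
  (* A rank [r] below d + (p - 1) would contradict the family of that size supplied by [jump]. *)
  move=> jump; rewrite /= leqNgt; apply/negP => lt; apply: nSr; apply: has_independentW lt _.
  apply: jump => // [u Su|i|i]; first by rewrite -act_exp // gp1 act1.
    exact: TS.
  by have [_ ->] := (TE (x i)).1 (Tx i).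
left; rewrite -DS -DT; apply: eq_z_rank => s; split; last first.
  by case=> z Tz z_ind; exists z; auto.
apply: has_independent_fixed => g u Gg Su.
apply: (@torsion_act_gen A) (subsetP genG g Gg) Su.
  by apply/subsetP=> h; rewrite inE => /andP[].
by move=> h u' Ah Su'; apply: NNPP => nt; apply: no_ntors; exists h, u'.
Qed.

End Dichotomy.

(** * Evaluation of homogeneous polynomials and homogeneous coordinates *)

(** Serves both for [j] an endomorphism of algC fixing the image of K, with [k] and [h] equal, and
    for a tower K, L, algC. *)
Lemma meval_map (n : nat) (A B C : comNzRingType) (k : {rmorphism A -> B})
    (j : {rmorphism B -> C}) (h : {rmorphism A -> C}) (q : {mpoly A[n]}) x :
  (forall a, j (k a) = h a) ->
  j (map_mpoly k q).@[x] = (map_mpoly h q).@[j \o x].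
Proof.
move=> jk; elim/mpolyind: q => [|c m q _ _ IHq]; first by rewrite !raddf0.
rewrite !raddfD /= IHq; congr (_ + _).
rewrite !map_mpolyZ !map_mpolyX !mevalZ !mevalX rmorphM jk rmorph_prod.
by congr (_ * _); apply: eq_bigr => i _; rewrite rmorphXn.
Qed.

(** Separate factors for the variables let this cover the homogeneous and the bihomogeneous case
    together. *)
Lemma meval_scale (n : nat) (R : comNzRingType) (q : {mpoly R[n]}) (t x : 'I_n -> R) c :
  (forall m, m \in msupp q -> \prod_i t i ^+ m i = c) ->
  q.@[fun i => t i * x i] = c * q.@[x].
Proof.
move=> tc; rewrite !mevalE mulr_sumr; apply: eq_big_seq => m /tc <-.
rewrite mulrCA -big_split; congr (_ * _); apply: eq_bigr => i _.
by rewrite exprMn.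
Qed.

Lemma meval_homog (n d : nat) (R : comNzRingType) (q : {mpoly R[n]}) c (x : 'I_n -> R) :
  q \is d.-homog -> q.@[fun i => c * x i] = c ^+ d * q.@[x].
Proof.
move=> /dhomogP q_d; apply: meval_scale => m /q_d <-.
by rewrite prodrXr /= mdegE.
Qed.

Lemma dhomog_map (n d : nat) (K F : fieldType) (j : {rmorphism K -> F}) (q : {mpoly K[n]}) :
  q \is d.-homog -> map_mpoly j q \is d.-homog.
Proof.
move=> /dhomogP q_d; apply/dhomogP => m.
by rewrite (perm_mem (msupp_map_mpoly _ (fmorph_inj j))) => /q_d.
Qed.

Lemma bihomog_map (n d e : nat) (K F : fieldType) (j : {rmorphism K -> F})
    (q : {mpoly K[n.+1 + n.+1]}) :
  bihomog d e q -> bihomog d e (map_mpoly j q).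
Proof.
move=> /allP q_de; apply/allP => m.
by rewrite (perm_mem (msupp_map_mpoly _ (fmorph_inj j))) => /q_de.
Qed.

(** Names the argument at which [eval2] evaluates its polynomials. *)
Definition pair_coord (R : Type) (n : nat) (x y : 'I_n.+1 -> R)
    (k : 'I_(n.+1 + n.+1)) : R :=
  match split k with inl a => x a | inr b => y b end.

Lemma meval_bihomog (n d e : nat) (R : comNzRingType) (q : {mpoly R[n.+1 + n.+1]})
    a b (x y : 'I_n.+1 -> R) :
  bihomog d e q ->
  q.@[pair_coord (fun i => a * x i) (fun i => b * y i)] =
    a ^+ d * b ^+ e * q.@[pair_coord x y].
Proof.
move=> /allP q_de.
rewrite -(@meval_scale _ _ _ (pair_coord (fun=> a) (fun=> b))) => [|m /q_de].
  by apply: meval_eq => k; rewrite /pair_coord; case: split.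
case/andP=> /eqP <- /eqP <-; rewrite big_split_ord /=.
congr (_ * _); rewrite -prodrXr; apply: eq_bigr => i _.
  by rewrite /pair_coord (unsplitK (inl _)).
by rewrite /pair_coord (unsplitK (inr _)).
Qed.

Lemma line_scale (F : fieldType) (n : nat) (v w : 'rV[F]_n) :
  w != 0 -> <[v]>%VS = <[w]>%VS -> exists2 c, c != 0 & w = c *: v.
Proof.
move=> w0 vw; have /vlineP[c Dw] : (w \in <[v]>)%VS by rewrite vw memv_line.
by exists c => //; apply: contraNneq w0 => c0; rewrite Dw c0 scale0r.
Qed.

Lemma scale_line (F : fieldType) (n : nat) c (v : 'rV[F]_n) :
  c != 0 -> <[c *: v]>%VS = <[v]>%VS.
Proof.
move=> c0; apply/eqP; rewrite eqEsubv -!memvE memvZ ?memv_line //=.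
by rewrite -{1}[v](scalerK c0) memvZ ?memv_line.
Qed.

Definition hrow (F : fieldType) (n : nat) (P : proj_space F n) : 'rV[F]_n.+1 :=
  vpick (val P).

Lemma hrow_neq0 (F : fieldType) (n : nat) (P : proj_space F n) : hrow P != 0.
Proof. by rewrite vpick0 -dimv_eq0 (eqP (valP P)). Qed.

Lemma line_hrow (F : fieldType) (n : nat) (P : proj_space F n) :
  val P = <[hrow P]>%VS.
Proof.
apply/esym/eqP; rewrite eqEdim -memvE memv_pick dim_vline hrow_neq0.
by rewrite (eqP (valP P)).
Qed.

Lemma hcoord_line (F : fieldType) (n : nat) (P : proj_space F n) v :
  val P = <[v]>%VS -> exists2 c, c != 0 & hcoord P = fun i => c * v 0 i.
Proof.
rewrite line_hrow => /esym /line_scale - /(_ (hrow_neq0 P))[c c0 Dv].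
by exists c => //; apply: functional_extensionality => i; rewrite /hcoord -/(hrow P) Dv mxE.
Qed.

(** * Conjugation of points and rationality under morphisms over K *)

Section GaloisAction.

Variables (K : fieldType) (iota : {rmorphism K -> algC}).

Lemma geom_point_inj (X : proj_variety iota) (P Q : geom_point X) :
  line_of P = line_of Q -> P = Q.
Proof. by move=> PQ; do 2!apply: val_inj. Qed.

Lemma line_of_neq0 (X : proj_variety iota) (P : geom_point X) v :
  line_of P = <[v]>%VS -> v != 0.
Proof.
move=> Pv; have := valP (val P); rewrite -/(line_of P) Pv dim_vline.
by case: (v == 0).
Qed.

Section Conj.

Variable nu : {rmorphism algC -> algC}.
Hypothesis nu_iota : forall a, nu (iota a) = iota a.

Fact conj_proj_subproof n (P : proj_space algC n) :
  \dim <[map_mx nu (hrow P)]> == 1.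
Proof. by rewrite dim_vline map_mx_eq0 hrow_neq0. Qed.

Definition conj_proj n (P : proj_space algC n) : proj_space algC n :=
  exist _ <[map_mx nu (hrow P)]>%VS (conj_proj_subproof P).

Variable X : proj_variety iota.

Fact conj_point_subproof (P : geom_point X) : on_variety (conj_proj (val P)).
Proof.
(* The chosen coordinates of the conjugate are [c] times the conjugated ones; homogeneity absorbs
   [c], and [nu] fixes the coefficients of the equations. *)
have [c c0 Dc] := hcoord_line (erefl (val (conj_proj (val P)))).
have := valP P; rewrite /on_variety /zero_locus !all_map => /allP XP.
apply/allP => q q_in /=; have /homogP[d q_d] := allP (equations_homog X) q q_in.
rewrite Dc (meval_homog _ _ (dhomog_map _ q_d)).
rewrite (@meval_eq _ _ _ (nu \o hcoord (val P))) => [|i]; last by rewrite mxE.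
by rewrite -(meval_map _ _ nu_iota) (eqP (XP q q_in)) rmorph0 mulr0.
Qed.

Definition conj_point (P : geom_point X) : geom_point X :=
  exist _ (conj_proj (val P)) (conj_point_subproof P).

(** Conjugation does not depend on the chosen coordinates: a scalar c between two generators becomes
    [nu c], again nonzero. *)
Lemma line_conj_point P v :
  line_of P = <[v]>%VS -> line_of (conj_point P) = <[map_mx nu v]>%VS.
Proof.
move=> Pv; have Pv' := Pv; rewrite /line_of line_hrow in Pv'.
have [c c0 ->] := line_scale (line_of_neq0 Pv) Pv'.
by rewrite map_mxZ scale_line // fmorph_eq0.
Qed.

Lemma eval2_conj f (P Q : geom_point X) d e :
  (forall i, bihomog d e (f i)) ->
  exists2 c, c != 0 &
    eval2 f (conj_point P) (conj_point Q) = c *: map_mx nu (eval2 f P Q).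
Proof.
move=> f_de; have [a a0 Da] := hcoord_line (erefl (val (conj_proj (val P)))).
have [b b0 Db] := hcoord_line (erefl (val (conj_proj (val Q)))).
exists (a ^+ d * b ^+ e); first by rewrite mulf_neq0 ?expf_neq0.
apply/rowP=> i; rewrite !mxE -/(pair_coord _ _) /= Da Db.
rewrite (meval_bihomog _ _ _ _ (bihomog_map _ (f_de i))) (meval_map _ _ nu_iota).
congr (_ * _); apply: meval_eq => k; rewrite /pair_coord /=.
by case: split => j; rewrite mxE.
Qed.

End Conj.

Section Rational.

Variables (L : fieldType) (k : {rmorphism K -> L}) (j : {rmorphism L -> algC}).
Hypothesis jk : forall a, j (k a) = iota a.
Variable X : proj_variety iota.

Lemma rational_hcoord (P : geom_point X) : rational_point j P ->
  exists a, exists2 v : 'rV[L]_(ambient_dim X).+1, a != 0 &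
    hcoord (val P) = fun i => a * j (v 0 i).
Proof.
case=> v v0 /hcoord_line[a a0 Da]; exists a, v => //.
by rewrite Da; apply: functional_extensionality => i; rewrite mxE.
Qed.

Lemma rational_line (P : geom_point X) v a :
  line_of P = <[a *: map_mx j v]>%VS -> rational_point j P.
Proof.
move=> Pv; have := line_of_neq0 Pv; rewrite scaler_eq0 negb_or => /andP[a0 v0].
by exists v; [rewrite map_mx_eq0 in v0 | rewrite Pv scale_line].
Qed.

(** Local formulas with coefficients in K send coordinates in L to coordinates in L; the scalar [a]
    only contributes the factor [a ^+ d]. *)
Lemma rational_morphism1 phi (P : geom_point X) :
  morphism1 phi -> rational_point j P -> rational_point j (phi P).
Proof.
move=> /(_ P)[f [d [f_d fP /(_ P fP) phiP]]] /rational_hcoord[a [v a0 Dv]].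
apply: (@rational_line _ (\row_i (map_mpoly k (f i)).@[fun i => v 0 i]) (a ^+ d)).
rewrite phiP; congr <[_]>%VS; apply/rowP=> i; rewrite !mxE Dv.
by rewrite (meval_homog _ _ (dhomog_map _ (f_d i))) (meval_map _ _ jk).
Qed.

Lemma rational_morphism2 phi (P Q : geom_point X) :
  morphism2 phi -> rational_point j P -> rational_point j Q ->
  rational_point j (phi P Q).
Proof.
move=> /(_ P Q)[f [d [e [f_de fPQ /(_ P Q fPQ) phiPQ]]]].
move=> /rational_hcoord[a [v a0 Dv]] /rational_hcoord[b [w b0 Dw]].
pose vw := pair_coord (fun i => v 0 i) (fun i => w 0 i).
apply: (@rational_line _ (\row_i (map_mpoly k (f i)).@[vw]) (a ^+ d * b ^+ e)).
rewrite phiPQ; congr <[_]>%VS; apply/rowP=> i; rewrite !mxE -/(pair_coord _ _) Dv Dw.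
rewrite (meval_bihomog _ _ _ _ (bihomog_map _ (f_de i))) (meval_map _ _ jk).
congr (_ * _); apply: meval_eq => l.
by rewrite /vw /pair_coord /=; case: split.
Qed.

End Rational.

(** The formulas valid near (P, Q) also apply at the conjugate pair, where their value is a nonzero
    multiple of the conjugated value. *)
Lemma conj_morphism2 (nu : {rmorphism algC -> algC})
    (nu_iota : forall a, nu (iota a) = iota a) (X : proj_variety iota) phi
    (P Q : geom_point X) :
  morphism2 phi ->
  conj_point nu_iota (phi P Q) = phi (conj_point nu_iota P) (conj_point nu_iota Q).
Proof.
move=> /(_ P Q)[f [d [e [f_de fPQ phi_f]]]]; apply: geom_point_inj.
have [c c0 Dc] := eval2_conj nu_iota P Q f_de.
have fPQ' : eval2 f (conj_point nu_iota P) (conj_point nu_iota Q) != 0.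
  by rewrite Dc scaler_eq0 negb_or c0 map_mx_eq0.
rewrite (phi_f _ _ fPQ') Dc scale_line //.
exact/line_conj_point/phi_f.
Qed.

End GaloisAction.

(** * Conjugation as an endomorphism of the group of points *)

Section PointAction.

Variables (K : fieldType) (iota : {rmorphism K -> algC}) (A : abelian_variety iota).
Variable nu : {rmorphism algC -> algC}.
Hypothesis nu_iota : forall a, nu (iota a) = iota a.

Definition conj_av (P : av_points A) : av_points A := conj_point nu_iota P.

Lemma conj_av_zmod_morphism : zmod_morphism conj_av.
Proof.
have conjD P Q : conj_av (P + Q) = conj_av P + conj_av Q.
  exact/conj_morphism2/av_add_morphism.
by move=> P Q; rewrite -[in RHS](subrK Q P) [in RHS]conjD addrK.
Qed.

HB.instance Definition _ :=
  GRing.isZmodMorphism.Build (av_points A) (av_points A) conj_av conj_av_zmod_morphism.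

End PointAction.

(** * The Galois group acting on A(L), and descent to A(K) *)

Section GaloisRank.

Variables (K : fieldExtType rat) (iota_K : {rmorphism K -> algC}).
Variable A : abelian_variety iota_K.
Variables (L : splittingFieldType K) (iota_L : {rmorphism L -> algC}).
Hypothesis iota_KL : forall a : K, iota_L (a%:A)%R = iota_K a.

(* The chosen extensions to algC do not compose like the elements of the Galois
   group; they do so on L, hence gal_act is a group action on A(L) only. *)
Lemma extend_gal (s : gal_of {:L}) :
  {nu : {rmorphism algC -> algC} | forall x, nu (iota_L x) = iota_L (s x)}.
Proof.
have [nu Dnu] := @extend_algC_subfield_aut (baseFieldType L) iota_L (s : {rmorphism L -> L}).
by exists nu => x; rewrite -Dnu.
Qed.

Definition gal_ext s := sval (extend_gal s).

Lemma gal_extE s x : gal_ext s (iota_L x) = iota_L (s x).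
Proof. exact: (svalP (extend_gal s)). Qed.

Lemma gal_ext_base s a : gal_ext s (iota_K a) = iota_K a.
Proof. by rewrite -iota_KL gal_extE linearZ rmorph1. Qed.

Definition gal_act s : {additive av_points A -> av_points A} :=
  @conj_av _ _ A _ (gal_ext_base s).

Local Notation rational_L :=
  (fun P : av_points A => rational_point iota_L (P : geom_point A)).
Local Notation rational_K :=
  (fun P : av_points A => rational_point iota_K (P : geom_point A)).

Lemma line_gal_act s (P : av_points A) v :
  line_of (P : geom_point A) = <[map_mx iota_L v]>%VS ->
  line_of (gal_act s P : geom_point A) = <[map_mx iota_L (map_mx s v)]>%VS.
Proof.
move/(line_conj_point (gal_ext_base s)) => ->; congr <[_]>%VS.
by apply/matrixP=> i j; rewrite !mxE gal_extE.
Qed.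

Lemma rational_base P : rational_K P -> rational_L P.
Proof.
case=> v v0 Pv; exists (map_mx (in_alg L) v); first by rewrite map_mx_eq0.
by rewrite Pv; congr <[_]>%VS; apply/matrixP=> i j; rewrite !mxE iota_KL.
Qed.

Lemma rational_fixed P : galois 1 {:L} ->
  rational_K P <->
  rational_L P /\ forall s, s \in 'Gal({:L} / 1)%g -> gal_act s P = P.
Proof.
move=> galL; split=> [KP|[[v v0 Pv] fixP]].
  split=> [|s _]; first exact: rational_base.
  case: KP => v v0 Pv; apply: geom_point_inj.
  rewrite (line_conj_point (gal_ext_base s) Pv) Pv; congr <[_]>%VS.
  by apply/matrixP=> i j; rewrite !mxE gal_ext_base.
have [i vi0] : exists i, v 0 i != 0 by apply/rV0Pn.
(* Scaling one coordinate to 1 turns invariance of the line into invariance of the vector: the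
   factor [c] below is read off at [i]. *)
have [u ui Pu] : exists2 u : 'rV[L]_(ambient_dim A).+1, u 0 i = 1 &
    line_of (P : geom_point A) = <[map_mx iota_L u]>%VS.
  exists ((v 0 i)^-1 *: v); first by rewrite mxE mulVf.
  by rewrite map_mxZ scale_line // fmorph_eq0 invr_eq0.
have u_fix s l : s \in 'Gal({:L} / 1)%g -> s (u 0 l) = u 0 l.
  move=> /fixP sP; have := line_gal_act s Pu; rewrite sP => Psu.
  have Psu' := Psu; rewrite Pu in Psu'.
  have [c _ Dc] := line_scale (line_of_neq0 Psu) Psu'.
  have c1 : c = 1.
    by have /rowP/(_ i) := Dc; rewrite !mxE ui !rmorph1 mulr1.
  by apply: (fmorph_inj iota_L); have /rowP/(_ l) := Dc; rewrite c1 scale1r !mxE.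
(* Every coordinate is fixed by the Galois group, hence lies in K. *)
have /fin_all_exists[w Dw] l : exists a, u 0 l = a%:A.
  apply/vlineP; rewrite -(galois_fixedField galL).
  by apply/fixedFieldP; rewrite ?memvf // => s /u_fix.
exists (\row_l w l).
  apply/rV0Pn; exists i; rewrite mxE; apply: contra_eq_neq (Dw i) => ->.
  by rewrite scale0r ui oner_neq0.
by rewrite Pu; congr <[_]>%VS; apply/rowP=> l; rewrite !mxE -iota_KL -Dw.
Qed.

Lemma mw_rank_dichotomy p : prime p -> galois 1 {:L} ->
    gen_by_exponent p 'Gal({:L} / 1)%g ->
  mw_rank A iota_L = mw_rank A iota_K \/
  enat_le (enat_add (mw_rank A iota_K) (Fin p.-1)) (mw_rank A iota_L).
Proof.
move=> p_pr galL genG; have jk a : iota_L (in_alg L a) = iota_K a := iota_KL a.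
apply: (@z_rank_dichotomy _ [group of 'Gal({:L} / 1)%g] _ gal_act) p_pr genG.
- by apply: rational_base; apply: av_zero_rational.
- move=> P Q SP SQ; apply: (rational_morphism2 jk (@av_add_morphism _ _ A)) => //.
  exact: (rational_morphism1 jk (@av_opp_morphism _ _ A)).
- move=> s P _ [v v0 Pv]; exists (map_mx s v); first by rewrite map_mx_eq0.
  exact: line_gal_act.
- move=> P [v v0 Pv]; apply: geom_point_inj; rewrite (line_gal_act _ Pv) Pv.
  by congr <[map_mx _ _]>%VS; apply/matrixP=> i j; rewrite mxE gal_id.
- move=> s t P _ _ [v v0 Pv]; apply: geom_point_inj.
  (* In the Galois group [(s * t) x = t (s x)], which is the order of composition in [actM]. *)
  rewrite (line_gal_act _ Pv) (line_gal_act _ (line_gal_act _ Pv)).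
  by congr <[map_mx _ _]>%VS; apply/matrixP=> i j; rewrite !mxE galM ?memvf.
- by move=> P; apply: rational_fixed.
Qed.

End GaloisRank.

(* L has a structure of K-algebra, and iota_L is an embedding of L in algC that
   extends the one of K. *)
Theorem theorem2p5
  (K : fieldExtType rat) (iota_K : {rmorphism K -> algC})
  (A : abelian_variety iota_K)
  (p : nat) (p_prime : prime p) (p_gt2 : (2 < p)%N)
  (L : splittingFieldType K) (iota_L : {rmorphism L -> algC})
  (iota_KL : forall a : K, iota_L (a%:A)%R = iota_K a)
  (L_galois : galois 1 {:L})
  (L_gal : ('Gal({:L} / 1) \isog SL2 p)%g \/ ('Gal({:L} / 1) \isog PSL2 p)%g) :
  mw_rank A iota_L = mw_rank A iota_K \/
  enat_le (enat_add (mw_rank A iota_K) (Fin ((p - 1) %/ 2))) (mw_rank A iota_L).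
Proof.
have genG : gen_by_exponent p 'Gal({:L} / 1)%g.
  have genSL := SL2_gen_by_exponent p_prime.
  case: L_gal => [/gen_by_exponent_isog|]; first exact.
  (* PSL_2 is the image of SL_2 under the quotient map, so it inherits the generation property. *)
  move=> /(gen_by_exponent_isog (H := (SL2 p / 'Z(SL2 p))%G)); apply.
  exact/gen_by_exponent_morphim/genSL/normal_norm/center_normal.
have [->|le] := mw_rank_dichotomy A iota_KL p_prime L_galois genG; first by left.
right; move: le; case: (mw_rank A iota_K) (mw_rank A iota_L) => [m|] [n|] //=.
(* The jump of p - 1 is at least (p - 1)/2. *)
by apply: leq_trans; rewrite leq_add2l -subn1 leq_div.
Qed.
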